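(* Let $h:\mathbb{R}\to[0,\infty)$ be a convex function with $h(0)=0$, and let $c=c_1+c_2$ be the separable cost on $\mathbb{R}^2\times\mathbb{R}^2$ with $c_i(x_i,y_i)=h(|x_i-y_i|)$, $i=1,2$. Let $\mu,\nu\in\mathcal{P}(\mathbb{R}^2)$ and assume that $\mu(\{x_2=0\})=1$. Then the optimal cardinal flow $(f^{(1)},f^{(2)})$ between $\mu$ and $\nu$ is defined as $$f^{(1)}:=\big(F^{[-1]}_{\mu_1},F^{[-1]}_{\nu_1}\big)_\#\mathcal{L}_{|[0,1]}\otimes\delta_0,\qquad f^{(2)}:=\Big(\delta_0\otimes\big(F^{[-1]}_{\nu_{|y_1}}\big)_\#\mathcal{L}_{|[0,1]}\Big)\otimes\nu_1.$$ In particular, $$W_c(\mu,\nu)=W_{c_1}(\mu_1,\nu_1)+\int_{\mathbb{R}}W_{c_2}(\delta_0,\nu_{|y_1})\,d\nu_1(y_1).$$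
   Context: $\mathcal{P}(Z)$ denotes the Borel probability measures on $Z$; $T_\#$ denotes push-forward; $\mathfrak{p}_A$ denotes the projection onto the factor(s) $A$. Here $X=X_1\times X_2=\mathbb{R}^2$ with points $\mathbf{x}=(x_1,x_2)$ and $Y=Y_1\times Y_2=\mathbb{R}^2$ with points $\mathbf{y}=(y_1,y_2)$, all factors being $\mathbb{R}$. The cost is $c(\mathbf{x},\mathbf{y})=c_1(x_1,y_1)+c_2(x_2,y_2)$. $W_c(\mu,\nu)=\inf_{\pi\in\Pi(\mu,\nu)}\int c\,d\pi$, where $\Pi(\mu,\nu)$ is the set of transportation plans (couplings), i.e. probability measures on $X\times Y$ with marginals $\mu$ and $\nu$; $W_{c_1},W_{c_2}$ are defined in the same way on $\mathcal{P}(\mathbb{R})\times\mathcal{P}(\mathbb{R})$. Cardinal flows: $\mathcal{F}(\mu,\nu)$ is the set of pairs $(f^{(1)},f^{(2)})\in\mathcal{P}(X\times Y_1)\times\mathcal{P}(X_2\times Y)$ such that $(\mathfrak{p}_X)_\#f^{(1)}=\mu$, $(\mathfrak{p}_Y)_\#f^{(2)}=\nu$ and $(\mathfrak{p}_{Y_1\times X_2})_\#f^{(1)}=(\mathfrak{p}_{Y_1\times X_2})_\#f^{(2)}$. A cardinal flow is optimal if it minimizes $\int c_1\,df^{(1)}+\int c_2\,df^{(2)}$ over $\mathcal{F}(\mu,\nu)$. $\mu_1,\nu_1$ are the first marginals of $\mu,\nu$; $\nu_{|y_1}\in\mathcal{P}(\mathbb{R})$ is the conditional law of the second coordinate under $\nu$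 given the first coordinate $y_1$. For $\rho\in\mathcal{P}(\mathbb{R})$, $F_\rho(t)=\rho((-\infty,t])$ is the cumulative function and $F_\rho^{[-1]}(s)=\inf\{t:F_\rho(t)\ge s\}$ its pseudo-inverse. $\mathcal{L}_{|[0,1]}$ is the Lebesgue measure restricted to $[0,1]$ and $\delta_0$ the Dirac mass at $0\in\mathbb{R}$. In the formula for $f^{(1)}$, the push-forward measure is the joint law of $(x_1,y_1)$ and $\delta_0$ is the law of $x_2$. In the formula for $f^{(2)}$, for each $y_1$ the product $\delta_0\otimes(F^{[-1]}_{\nu_{|y_1}})_\#\mathcal{L}_{|[0,1]}$ is the conditional law of $(x_2,y_2)$ given $y_1$, and $\nu_1$ is the law of $y_1$; i.e. $\int\phi\,df^{(2)}=\int_{\mathbb{R}}\int\phi(0,y_1,y_2)\,d\big((F^{[-1]}_{\nu_{|y_1}})_\#\mathcal{L}_{|[0,1]}\big)(y_2)\,d\nu_1(y_1)$ for $\phi=\phi(x_2,y_1,y_2)$. *)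

(* Defs.v *)
From HB Require Import structures.
From mathcomp Require Import all_boot all_order all_algebra.
From mathcomp Require Import all_classical all_reals all_analysis.

Set Implicit Arguments.
Unset Strict Implicit.
Unset Printing Implicit Defensive.

Import Order.TTheory GRing.Theory Num.Theory.
Import numFieldNormedType.Exports.

Local Open Scope classical_set_scope.
Local Open Scope ring_scope.
Local Open Scope ereal_scope.

Section first_marginal.
Context d1 d2 (T1 : measurableType d1) (T2 : measurableType d2)
  (R : realType).

Definition marginal1 (P : probability (T1 * T2)%type R) : set T1 -> \bar R :=
  pushforward P fst.

Variable P : probability (T1 * T2)%type R.

Let marginal1_measure : {measure set T1 -> \bar R} :=
  measure_function_pushforward__canonical__measure_function_Measure P
    measurable_fst.

HB.instance Definition _ := Measure.copy (marginal1 P) marginal1_measure.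

Let marginal1_setT : marginal1 P [set: T1] = 1.
Proof. by rewrite /marginal1 /pushforward preimage_setT probability_setT. Qed.

HB.instance Definition _ :=
  Measure_isProbability.Build _ _ _ (marginal1 P) marginal1_setT.

End first_marginal.

Section optimal_transport.
Context d1 d2 (T1 : measurableType d1) (T2 : measurableType d2)
  (R : realType).

Definition is_coupling (mu : probability T1 R) (nu : probability T2 R)
    (pi : probability (T1 * T2)%type R) : Prop :=
  (forall A, measurable A -> pushforward pi fst A = mu A) /\
  (forall B, measurable B -> pushforward pi snd B = nu B).

Definition W (c : T1 -> T2 -> R) (mu : probability T1 R)
    (nu : probability T2 R) : \bar R :=
  ereal_inf [set \int[pi]_p (c p.1 p.2)%:E | pi in is_coupling mu nu].

End optimal_transport.

Section cardinal_flow.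
Context (R : realType).

Definition is_cardinal_flow (mu nu : probability (R * R)%type R)
    (f1 : probability ((R * R) * R)%type R)
    (f2 : probability (R * (R * R))%type R) : Prop :=
  [/\ forall A, measurable A -> pushforward f1 fst A = mu A,
      forall A, measurable A -> pushforward f2 snd A = nu A
    & forall A : set (R * R), measurable A ->
        pushforward f1 (fun p => (p.2, p.1.2)) A
        = pushforward f2 (fun q => (q.2.1, q.1)) A].

Definition flow_cost (c1 c2 : R -> R -> R)
    (f1 : probability ((R * R) * R)%type R)
    (f2 : probability (R * (R * R))%type R) : \bar R :=
  \int[f1]_p (c1 p.1.1 p.2)%:E + \int[f2]_q (c2 q.1 q.2.2)%:E.

Definition is_optimal_cardinal_flow (c1 c2 : R -> R -> R)
    (mu nu : probability (R * R)%type R)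
    (f1 : probability ((R * R) * R)%type R)
    (f2 : probability (R * (R * R))%type R) : Prop :=
  is_cardinal_flow mu nu f1 f2 /\
  forall g1 g2, is_cardinal_flow mu nu g1 g2 ->
    flow_cost c1 c2 f1 f2 <= flow_cost c1 c2 g1 g2.

Definition distance_cost (h : R -> R) (x y : R) : R := h `|x - y|%R.

Definition separable_cost (c1 c2 : R -> R -> R) (x y : R * R) : R :=
  (c1 x.1 y.1 + c2 x.2 y.2)%R.

End cardinal_flow.

Section conditional_law.
Context d1 d2 (T1 : measurableType d1) (T2 : measurableType d2)
  (R : realType).

(* [k] is a version of the regular conditional law of the second coordinate
   given the first one; it is only determined almost everywhere. *)
Definition is_conditional_law (nu : probability (T1 * T2)%type R)
    (k : T1 -> pprobability T2 R) : Prop :=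
  measurable_fun [set: T1] k /\
  forall A B, measurable A -> measurable B ->
    nu (A `*` B) = \int[marginal1 nu]_(x in A) k x B.

End conditional_law.

Section quantile.
Context (R : realType).

Definition cumulative_function (rho : probability R R) (t : R) : \bar R :=
  rho `]-oo, t]%classic.

(* The infimum is taken in [R] and is [0] by convention when the set is empty
   or unbounded from below; for [s] in [0, 1] this only happens at [s = 0] and
   possibly [s = 1], which Lebesgue measure ignores. *)
Definition quantile (rho : probability R R) (s : R) : R :=
  inf [set t | s%:E <= cumulative_function rho t].

Definition lebesgue01 : set R -> \bar R :=
  mrestr (@lebesgue_measure R) (measurable_itv `[0%R, 1%R]).

(* The product is the law of ((x1, y1), x2), reordered into ((x1, x2), y1). *)
Definition quantile_flow1 (mu nu : probability (R * R)%type R) :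
    set ((R * R) * R) -> \bar R :=
  pushforward
    (pushforward lebesgue01
       (fun s => (quantile (marginal1 mu) s, quantile (marginal1 nu) s))
     \x \d_(0%R : R))
    (fun p : (R * R) * R => ((p.1.1, p.2), p.1.2)).

(* Given [y1], the product is the conditional law of (x2, y2); the points of the
   space are ordered as (x2, (y1, y2)). *)
Definition quantile_flow2 (nu : probability (R * R)%type R)
    (k : R -> pprobability R R) (A : set (R * (R * R))) : \bar R :=
  \int[marginal1 nu]_y1
    (\d_(0%R : R) \x pushforward lebesgue01 (quantile (k y1)))
      [set p | A (p.1, (y1, p.2))].

End quantile.

(* Main.v *)
(* Since mu lives on the axis x2 = 0, every plan and every cardinal flow pays
   the same second cost, the integral of h(|y2|) under nu, so only the first
   cost is optimized, and there the problem is one-dimensional transport from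
   mu_1 to nu_1.  The quantile coupling is optimal for it: h(|z|) is a limit
   from below of nonnegative combinations of the hinges (|z| - a)^+, a >= 0, and
   E (X - Y - a)^+ is the integral over t of P(Y < t, t + a <= X), a
   probability bounded below by 0 and by P(Y < t) + P(t + a <= X) - 1, and which
   the quantile coupling makes as small as possible for all t and a at once.
   Gluing the quantile coupling of mu_1 and nu_1 with the conditional laws of nu
   gives a plan with the cost of the quantile flow. *)
Require Import Defs.
From HB Require Import structures.
From mathcomp Require Import all_boot all_order all_algebra.
From mathcomp Require Import all_classical all_reals all_analysis.
From mathcomp Require Import measurable_realfun ring lra.

Import Order.TTheory GRing.Theory Num.Theory.
Import numFieldNormedType.Exports.

Local Open Scope classical_set_scope.
Local Open Scope ring_scope.

(** * Convex functions as limits of sums of hinges *)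

Section convex_hinges.
Set Implicit Arguments.
Unset Strict Implicit.
Context {R : realType}.
Variable h : R -> R.
Hypothesis h_ge0 : forall x, 0 <= h x.
Hypothesis h_convex : convex_function [set: R^o] h.
Hypothesis h0 : h 0 = 0.

(** The convexity inequality on [a, c] with denominators cleared: the case a = c stays included and
    later uses are plain arithmetic. *)
Lemma convex_three_points (a b c : R) : a <= b -> b <= c ->
  (c - a) * h b <= (c - b) * h a + (b - a) * h c.
Proof.
move=> ab bc; have [ac|ac] := eqVneq a c.
  by rewrite -ac in bc *; rewrite (_ : b = a); lra.
have ca0 : 0 < c - a by rewrite subr_gt0 lt_neqAle ac (le_trans ab).
have t01 : (0 <= (c - b) / (c - a) <= 1)%R.
  by rewrite divr_ge0 ?subr_ge0 ?(le_trans ab)//= ler_pdivrMr// mul1r; lra.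
pose t : {i01 R} := Itv01 (andP t01).1 (andP t01).2.
have : h ((c - b) / (c - a) * a + (1 - (c - b) / (c - a)) * c) <=
    (c - b) / (c - a) * h a + (1 - (c - b) / (c - a)) * h c.
  exact: (h_convex t (in_setT (a : convex_lmodType R^o))
                     (in_setT (c : convex_lmodType R^o))).
have -> : ((c - b) / (c - a)) * a + (1 - (c - b) / (c - a)) * c = b.
  by field; rewrite gt_eqF.
rewrite -(ler_pM2l ca0) => /le_trans; apply.
suff -> : (c - a) * ((c - b) / (c - a) * h a + (1 - (c - b) / (c - a)) * h c)
  = (c - b) * h a + (b - a) * h c by [].
by field; rewrite gt_eqF.
Qed.

(** The three points 0, x, y give y h(x) <= x h(y), and x h(y) <= y h(y) because h(y) >= 0. *)
Lemma convex_nondecreasing (x y : R) : 0 <= x -> x <= y -> h x <= h y.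
Proof.
move=> x_ge0 xy; have [->//|x0] := eqVneq x 0; first by rewrite h0.
have y0 : 0 < y by rewrite (lt_le_trans _ xy)// lt_neqAle eq_sym x0.
have := convex_three_points x_ge0 xy; rewrite h0 !subr0 mulr0 add0r.
move=> /le_trans /(_ (ler_wpM2r (h_ge0 y) xy)).
by rewrite ler_pM2l.
Qed.

(** Left of x the graph stays above the line through its points at x and x + 1. This bounds the loss
    caused by shifting the argument to the left. *)
Lemma convex_drop (x s : R) : 0 <= s -> h x - s * (h (x + 1) - h x) <= h (x - s).
Proof.
move=> s0; have := @convex_three_points (x - s) x (x + 1).
by rewrite lerBlDr lerDl s0 lerDl ler01 => /(_ isT isT); nra.
Qed.

Section hinges.
Variable d : R.
Hypothesis d_gt0 : 0 < d.

Definition secant_slope (k : nat) : R := (h (k.+1%:R * d) - h (k%:R * d)) / d.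

(** The change of slope of the shifted interpolant at its kink [k.+1 * d]. The interpolant is zero
    before the first kink, so the coefficient at [k = 0] is the whole first slope. *)
Definition slope_jump (k : nat) : R :=
  if k is k'.+1 then secant_slope k - secant_slope k' else secant_slope k.

(* Shifting the interpolant of [h] on the grid of step [d] to the right by [d]
   puts it below [h]; its kinks are the points [k.+1 * d]. *)
Definition hinge_sum (m : nat) (z : R) : R :=
  \sum_(k < m) slope_jump k * Num.max (z - k.+1%:R * d) 0.

Lemma slope_jump_ge0 k : 0 <= slope_jump k.
Proof.
rewrite /slope_jump /secant_slope; case: k => [|k].
  by rewrite divr_ge0 ?(ltW d_gt0)// subr_ge0 mul0r h0.
rewrite -mulrBl divr_ge0 ?(ltW d_gt0)//.
have := @convex_three_points (k%:R * d) (k.+1%:R * d) (k.+2%:R * d).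
rewrite !ler_pM2r// !ler_nat !leqnSn => /(_ isT isT).
rewrite -!natr1 !mulrDl mul1r; set x := k%:R * d => h3; rewrite -(ler_pM2l d_gt0); lra.
Qed.

Lemma hinge_sumS m z :
  hinge_sum m.+1 z = hinge_sum m z + slope_jump m * Num.max (z - m.+1%:R * d) 0.
Proof. by rewrite /hinge_sum big_ord_recr. Qed.

(** Past its last kink the sum is affine, and the jumps telescope to the last secant slope. The
    value h(m d) at [m.+1 * d] reflects the shift by one step. *)
Lemma hinge_sum_tail m z : m.+1%:R * d <= z ->
  hinge_sum m.+1 z = h (m%:R * d) + secant_slope m * (z - m.+1%:R * d).
Proof.
elim: m z => [|m IHm] z mz; rewrite hinge_sumS max_l ?subr_ge0//.
  by rewrite /hinge_sum big_ord0 mul0r h0.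
rewrite IHm; last by rewrite (le_trans _ mz)// ler_pM2r// ler_nat.
rewrite /slope_jump /secant_slope -!natr1 !mulrDl !mul1r.
by field; rewrite gt_eqF.
Qed.

(** Induction on the number of hinges. Past the new kink the sum lies on a secant shifted right by
    [d], hence below that secant since h is nondecreasing, and the extended secant lies below h. *)
Lemma hinge_sum_le m z : 0 <= z -> hinge_sum m z <= h z.
Proof.
move=> z0; elim: m => [|m IHm]; first by rewrite /hinge_sum big_ord0.
have [zm|/ltW mz] := leP z (m.+1%:R * d).
  by rewrite hinge_sumS max_r ?subr_le0// mulr0 addr0.
rewrite hinge_sum_tail//.
have := @convex_three_points (m%:R * d) (m.+1%:R * d) z.
rewrite ler_pM2r// ler_nat leqnSn => /(_ isT mz).
have : h (m%:R * d) <= h (m.+1%:R * d).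
  by apply: convex_nondecreasing; rewrite ?mulr_ge0 ?(ltW d_gt0)// ler_pM2r// ler_nat.
rewrite /secant_slope -natr1 mulrDl mul1r.
set x := m%:R * d; move=> hx h3; rewrite mulrAC -lerBrDl ler_pdivrMr//.
have := ler_wpM2l (ltW d_gt0) hx; lra.
Qed.

Lemma hinge_sum_ge0 m z : 0 <= hinge_sum m z.
Proof. by apply: sumr_ge0 => k _; rewrite mulr_ge0 ?slope_jump_ge0// le_max lexx orbT. Qed.

Lemma hinge_sum_homo m n z : (m <= n)%N -> hinge_sum m z <= hinge_sum n z.
Proof.
move=> /subnK <-; elim: (n - m)%N => [//|k IHk].
rewrite addSn hinge_sumS (le_trans IHk)// lerDl.
by rewrite mulr_ge0 ?slope_jump_ge0// le_max lexx orbT.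
Qed.

(** The sum at z dominates h at some grid point at most 2 d to the left of z; [convex_drop] turns
    this shift into the error term. *)
Lemma hinge_sum_ge m z : 0 <= z -> z <= m%:R * d ->
  h z - d *+ 2 * (h (z + 1) - h z) <= hinge_sum m z.
Proof.
move=> z0 zm.
have C0 : 0 <= h (z + 1) - h z by rewrite subr_ge0 convex_nondecreasing// lerDl.
suff [s [s0 sd hs]] : exists s, [/\ 0 <= s, s <= d *+ 2 & h (z - s) <= hinge_sum m z].
  apply: le_trans hs; apply: le_trans (convex_drop z s0).
  by rewrite lerB// ler_wpM2r.
have [zd|dz] := ltP z d.
  exists z; rewrite subrr h0 hinge_sum_ge0; split => //.
  by rewrite mulr2n (le_trans (ltW zd))// lerDl ltW.
pose n := Num.truncn (z / d).
have [nz zn] : n%:R * d <= z /\ z < n.+1%:R * d.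
  have /Num.Theory.truncn_itv/andP[] : 0 <= z / d by rewrite divr_ge0 ?(ltW d_gt0).
  by rewrite ler_pdivlMr// ltr_pdivrMr.
have n0 : (0 < n)%N.
  by rewrite -(ltr_nat R) -(ltrD2r 1) -(ltr_pM2r d_gt0) !natr1 mul1r (le_lt_trans dz).
have nm : (n <= m)%N.
  by rewrite -(ler_nat R) -(ler_pM2r d_gt0) (le_trans nz).
(* From here [n] is the predecessor: z lies between [n.+1 * d] and [n.+2 * d], where the sum of
   [n.+1] hinges is at least h(n d). *)
case: n n0 nz zn nm => // n _ nz zn nm.
exists (z - n%:R * d); rewrite subKr; split.
- by rewrite subr_ge0 (le_trans _ nz)// ler_pM2r// ler_nat.
- by move: zn; rewrite -!natr1 !mulrDl mul1r; lra.
apply: le_trans (hinge_sum_homo z nm); rewrite hinge_sum_tail//.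
rewrite lerDl mulr_ge0 ?subr_ge0// /secant_slope divr_ge0 ?(ltW d_gt0)// subr_ge0.
by apply: convex_nondecreasing; rewrite ?mulr_ge0 ?(ltW d_gt0)// ler_pM2r// ler_nat.
Qed.

End hinges.

(** Step 1/(n+1) with (n+1)^2 hinges puts the last kink at n + 1, so every z is eventually covered,
    while the error 2 (h(z+1) - h(z)) / (n+1) tends to 0. *)
Lemma cvg_hinge_sum z : 0 <= z ->
  (hinge_sum n.+1%:R^-1 (n.+1 * n.+1) z @[n --> \oo] --> h z).
Proof.
move=> z0.
have cvg_step : (n.+1%:R^-1 : R) *+ 2 * (h (z + 1) - h z) @[n --> \oo] --> 0.
  rewrite -(mul0r (h (z + 1) - h z)); apply: cvgMl.
  rewrite -[X in _ --> X](mul0rn _ 2); apply: cvgMn.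
  exact: cvg_harmonic.
apply: (@squeeze_cvgr _ _ _ _
  (fun n => h z - n.+1%:R^-1 *+ 2 * (h (z + 1) - h z)) (fun=> h z)).
- near=> n; apply/andP; split; last first.
    exact: hinge_sum_le.
  apply: hinge_sum_ge => //.
  rewrite natrM mulfK ?pnatr_eq0//.
  near: n; apply: filterS (nbhs_infty_ger z) => n /le_trans; apply.
  by rewrite ler_nat.
- by rewrite -[X in _ --> X]subr0; apply: cvgB; [exact: cvg_cst|].
- exact: cvg_cst.
Unshelve. all: by end_near. Qed.

End convex_hinges.

(** * Comparison of convex costs *)

Section hinge_integral.
Set Implicit Arguments.
Unset Strict Implicit.
Context d (T : measurableType d) (R : realType) (P : probability T R).
Variables X Y : T -> R.
Hypothesis mX : measurable_fun [set: T] X.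
Hypothesis mY : measurable_fun [set: T] Y.

Lemma measurable_hinge (a : R) :
  measurable_fun [set: T] (fun p => Num.max (X p - Y p - a) 0).
Proof. by apply: measurable_maxr => //; do !apply: measurable_funB. Qed.

Lemma measurable_lt_ge (t u : R) : measurable [set p | Y p < t /\ u <= X p].
Proof.
rewrite (_ : [set p | _] =
    (setT `&` Y @^-1` `]-oo, t[) `&` (setT `&` X @^-1` `[u, +oo[)); last first.
  by apply/seteqP; split => p; rewrite !setTI /= !in_itv/= andbT.
by apply: measurableI; [exact: mY|exact: mX].
Qed.

Let GR := measurableTypeR R.

Lemma measurable_lt_ge_graph (a : R) :
  measurable [set q : T * GR | Y q.1 < q.2 /\ q.2 + a <= X q.1].
Proof.
apply: measurableI; rewrite -[X in measurable X]setTI.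
  by apply: measurable_fun_ltr => //; exact: measurableT_comp.
apply: measurable_fun_le => //; first exact: measurable_funD.
exact: measurableT_comp.
Qed.

(** The positive part of X - Y - a is the length of ]Y, X - a]. Written as the integral of an
    indicator over t, it allows Tonelli to exchange the integrals. *)
Lemma integral_hinge (a : R) :
  (\int[P]_p (Num.max (X p - Y p - a) 0)%:E =
   \int[@lebesgue_measure R]_t P [set p | (Y p < t)%R /\ (t + a <= X p)%R])%E.
Proof.
pose E := [set q : T * GR | Y q.1 < q.2 /\ q.2 + a <= X q.1].
have mE : measurable E := measurable_lt_ge_graph a.
have mE1 : measurable_fun [set: T * GR] (EFin \o (\1_E : _ -> R)).
  exact/measurable_EFinP.
transitivity (\int[P]_p \int[@lebesgue_measure R]_t (\1_E (p, t))%:E)%E.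
  apply: eq_integral => p _ /=.
  transitivity (lebesgue_measure (`]Y p, X p - a]%classic : set R)).
    rewrite lebesgue_measure_itv/= lte_fin; case: ltP => yx.
      by rewrite max_l -?EFinB; [congr EFin|]; lra.
    by rewrite max_r//; lra.
  rewrite -[in LHS](setIT `]Y p, X p - a]%classic) -integral_indic//.
  apply: eq_integral => t _; congr EFin; rewrite !indicE; congr (nat_of_bool _)%:R.
  by apply/idP/idP; rewrite !inE /E/= in_itv/= lerBrDr => /andP.
etransitivity; first apply: (fubini_tonelli (EFin \o (\1_E : _ -> R))) => //.
  by move=> q; rewrite lee_fin.
apply: eq_integral => t _.
rewrite -[in RHS](setIT [set p | _]) -integral_indic//.
exact: measurable_lt_ge.
Qed.

Lemma measurable_lt_ge_fun (a : R) : measurable_fun [set: GR]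
  (fun t : GR => P [set p | Y p < t /\ t + a <= X p]).
Proof.
have := measurable_fun_ysection P (measurable_lt_ge_graph a).
apply: eq_measurable_fun => t _ /=; congr (P _).
by apply/seteqP; split => p; rewrite /ysection/= ?inE.
Qed.

(** As a >= 0, at most one of the two one-sided hinges is nonzero, the one selected by the sign of X
    - Y. *)
Lemma max_normB (a : R) p : 0 <= a -> Num.max (`|X p - Y p| - a) 0 =
  Num.max (X p - Y p - a) 0 + Num.max (Y p - X p - a) 0.
Proof.
move=> a0; have [xy|/ltW yx] := leP (X p) (Y p).
  by rewrite ler0_norm ?subr_le0// opprB [X in _ = X + _]max_r ?add0r//; lra.
by rewrite ger0_norm ?subr_ge0// [X in _ = _ + X]max_r ?addr0//; lra.
Qed.

End hinge_integral.

Section convex_cost_comparison.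
Set Implicit Arguments.
Unset Strict Implicit.
Context d d' (T : measurableType d) (T' : measurableType d') (R : realType).
Context (P : probability T R) (P' : probability T' R).
Variables (X Y : T -> R) (X' Y' : T' -> R).
Hypothesis mX : measurable_fun [set: T] X.
Hypothesis mY : measurable_fun [set: T] Y.
Hypothesis mX' : measurable_fun [set: T'] X'.
Hypothesis mY' : measurable_fun [set: T'] Y'.
Hypothesis le_lt_ge : forall t u,
  (P [set p | (Y p < t)%R /\ (u <= X p)%R] <=
   P' [set p | (Y' p < t)%R /\ (u <= X' p)%R])%E.
Hypothesis le_lt_ge_swap : forall t u,
  (P [set p | (X p < t)%R /\ (u <= Y p)%R] <=
   P' [set p | (X' p < t)%R /\ (u <= Y' p)%R])%E.

Lemma le_integral_hinge_norm (a : R) : 0 <= a ->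
  (\int[P]_p (Num.max (`|X p - Y p| - a) 0)%:E <=
   \int[P']_p (Num.max (`|X' p - Y' p| - a) 0)%:E)%E.
Proof.
move=> a0.
under eq_integral do rewrite max_normB// EFinD.
under [leRHS]eq_integral do rewrite max_normB// EFinD.
have mh d1 (T1 : measurableType d1) (U V : T1 -> R) :
    measurable_fun setT U -> measurable_fun setT V ->
    measurable_fun setT (fun p => (Num.max (U p - V p - a) 0)%:E).
  by move=> mU mV; apply/measurable_EFinP; exact: measurable_hinge.
have h0 (x : R) : (0 <= (Num.max x 0)%:E)%E by rewrite lee_fin le_max lexx orbT.
rewrite !ge0_integralD//; try exact: mh.
rewrite !integral_hinge//; apply: leeD; apply: ge0_le_integral => //;
  exact: measurable_lt_ge_fun.
Qed.

Variable h : R -> R.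
Hypothesis h_ge0 : forall x, 0 <= h x.
Hypothesis h_convex : convex_function [set: R^o] h.
Hypothesis h0 : h 0 = 0.

(** Replacing z by max(z, 0) makes h monotone on the whole line, hence measurable, and changes
    nothing at absolute values. *)
Lemma measurable_convex_norm d1 (T1 : measurableType d1) (U : T1 -> R) :
  measurable_fun [set: T1] U -> measurable_fun [set: T1] (fun p => h `|U p|).
Proof.
move=> mU; have mh : measurable_fun [set: R] (fun z => h (Num.max z 0)).
  apply: nondecreasing_measurable => // x y xy.
  apply: (convex_nondecreasing h_ge0 h_convex h0).
    by rewrite le_max lexx orbT.
  by rewrite ge_max !le_max xy lexx !orbT.
rewrite (_ : (fun p => _) = (fun z => h (Num.max z 0)) \o (fun p => `|U p|)).
  by apply: measurableT_comp => //; exact: measurableT_comp.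
by apply/funext => p /=; rewrite max_l.
Qed.

Lemma le_integral_hinge_sum e m : 0 < e ->
  (\int[P]_p (hinge_sum h e m `|X p - Y p|)%:E <=
   \int[P']_p (hinge_sum h e m `|X' p - Y' p|)%:E)%E.
Proof.
move=> e0; rewrite /hinge_sum.
have mh d1 (T1 : measurableType d1) (U V : T1 -> R) a :
    measurable_fun setT U -> measurable_fun setT V ->
    measurable_fun setT (fun p => (Num.max (`|U p - V p| - a) 0)%:E).
  move=> mU mV; apply/measurable_EFinP/measurable_maxr => //.
  apply: measurable_funB => //; apply: measurableT_comp => //.
  exact: measurable_funB.
have g0 (x : R) : (0 <= (Num.max x 0)%:E)%E by rewrite lee_fin le_max lexx orbT.
have w0 k : 0 <= slope_jump h e k.
  exact: (slope_jump_ge0 h_ge0 h_convex h0 e0).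
under eq_integral do rewrite -sumEFin.
under [leRHS]eq_integral do rewrite -sumEFin.
rewrite !ge0_integral_sum//; last first.
- by move=> k p _; rewrite lee_fin mulr_ge0// le_max lexx orbT.
- by move=> k; apply/measurable_EFinP/measurable_funM => //; exact/measurable_EFinP/mh.
- by move=> k p _; rewrite lee_fin mulr_ge0// le_max lexx orbT.
- by move=> k; apply/measurable_EFinP/measurable_funM => //; exact/measurable_EFinP/mh.
apply: lee_sum => k _.
under eq_integral do rewrite EFinM.
under [leRHS]eq_integral do rewrite EFinM.
rewrite !ge0_integralZl_EFin//; try exact: mh.
by apply: lee_wpmul2l; rewrite ?lee_fin// le_integral_hinge_norm// mulr_ge0// ltW.
Qed.

(** Fatou bounds the left side by the lower limit of the hinge-sum integrals under [P]; each is
    compared with its counterpart under [P'], which is at most the integral of h since the sums stay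
    below h. *)
Lemma le_integral_convex_cost :
  (\int[P]_p (h `|X p - Y p|)%:E <= \int[P']_p (h `|X' p - Y' p|)%:E)%E.
Proof.
pose psi n (z : R) := hinge_sum h n.+1%:R^-1 (n.+1 * n.+1) z.
have mpsi d1 (T1 : measurableType d1) (U V : T1 -> R) n :
    measurable_fun setT U -> measurable_fun setT V ->
    measurable_fun setT (fun p => (psi n `|U p - V p|)%:E).
  move=> mU mV; apply/measurable_EFinP; rewrite /psi /hinge_sum.
  apply: measurable_sum => k; apply: measurable_funM => //.
  apply: measurable_maxr => //; apply: measurable_funB => //.
  by apply: measurableT_comp => //; exact: measurable_funB.
have psi0 n z : (0 <= (psi n z)%:E)%E.
  by rewrite lee_fin (hinge_sum_ge0 h_ge0 h_convex h0).
have hE z : 0 <= z -> (h z)%:E = limn_einf (fun n => (psi n z)%:E).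
  move=> z0; suff /cvg_limn_einf_sup[-> _] :
    (psi n z)%:E @[n --> \oo] --> (h z)%:E by [].
  by apply: cvg_EFin; [exact: nearW|exact: cvg_hinge_sum].
under eq_integral do rewrite hE//.
apply: (le_trans (fatou P measurableT (fun n => mpsi _ _ _ _ n mX mY)
  (fun n x _ => psi0 n _))).
rewrite limn_einf_lim; apply: lime_le; first exact: is_cvg_einfs.
apply: nearW => n; apply: (@le_trans _ _ (\int[P]_p (psi n `|X p - Y p|)%:E)%E).
  by apply: ereal_inf_lbound; exists n => /=.
apply: (le_trans (le_integral_hinge_sum _ _)) => //.
apply: ge0_le_integral => //.
- by move=> p _; exact: psi0.
- exact: mpsi.
- apply/measurable_EFinP/measurable_convex_norm; exact: measurable_funB.
- by move=> p _; rewrite lee_fin (hinge_sum_le h_ge0 h_convex h0).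
Qed.

End convex_cost_comparison.

(** * Quantiles *)

Section image_probability.
Set Implicit Arguments.
Unset Strict Implicit.
Context d d' (T : measurableType d) (T' : measurableType d') (R : realType).
Variables (P : probability T R) (f : T -> T').
Hypothesis mf : measurable_fun [set: T] f.

Let mfun_f : {mfun T >-> T'} := HB.pack f (isMeasurableFun.Build _ _ _ _ f mf).

Definition image_probability : probability T' R := distribution P mfun_f.

Lemma ge0_integral_image_probability (g : T' -> \bar R) :
  measurable_fun [set: T'] g -> (forall y, 0 <= g y)%E ->
  (\int[image_probability]_y g y = \int[P]_x g (f x))%E.
Proof. by move=> mg g0; rewrite ge0_integral_distribution. Qed.

End image_probability.

Section lebesgue01_probability.
Context (R : realType).
Let mu01 : {measure set (measurableTypeR R) -> \bar R} :=
  mrestr (@lebesgue_measure R) (measurable_itv `[0, 1]).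

Let leb01_0 : @lebesgue01 R set0 = 0%E. Proof. exact: (measure0 mu01). Qed.
Let leb01_ge0 A : (0 <= @lebesgue01 R A)%E. Proof. exact: (measure_ge0 mu01). Qed.
Let leb01_sigma_additive : semi_sigma_additive (@lebesgue01 R : set R -> \bar R).
Proof. exact: (@measure_semi_sigma_additive _ _ _ mu01). Qed.

HB.instance Definition _ := isMeasure.Build default_measure_display R R
  (@lebesgue01 R) leb01_0 leb01_ge0 leb01_sigma_additive.

Let leb01_setT : @lebesgue01 R [set: R] = 1%E.
Proof.
by rewrite /lebesgue01 /mrestr setTI lebesgue_measure_itv/= lte_fin ltr01 oppr0 adde0.
Qed.

HB.instance Definition _ :=
  Measure_isProbability.Build _ _ _ (@lebesgue01 R) leb01_setT.

Lemma lebesgue01_itvo1 (r : R) : 0 <= r -> r <= 1 ->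
  lebesgue01 `]r, 1[%classic = (1 - r)%:E.
Proof.
move=> r0 r1; rewrite /lebesgue01 /mrestr setIidl; last first.
  by apply: subset_itv; rewrite bnd_simp.
rewrite lebesgue_measure_itv/= lte_fin EFinB; case: ltP => // r1'.
by rewrite (_ : r = 1) ?subee//; apply/eqP; rewrite eq_le r1.
Qed.

(** The endpoints 0 and 1 carry no mass, so sets need comparing only on ]0, 1[, where quantiles are
    true infima. *)
Lemma lebesgue01_subset (A B : set R) : measurable A -> measurable B ->
  (forall s, 0 < s < 1 -> A s -> B s) -> (lebesgue01 A <= lebesgue01 B)%E.
Proof.
move=> mA mB AB; pose D : set R := `]0, 1[%classic.
have mD : measurable D by exact: measurable_itv.
have DC0 : lebesgue01 (~` D) = 0%E.
  rewrite (probability_setC (@lebesgue01 R : probability R R) mD).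
  by rewrite [X in (1 - X)%E](lebesgue01_itvo1 (lexx 0) ler01) subr0 subee.
rewrite [leLHS](measureDI _ mA mD) [X in (X + _)%E](_ : _ = 0%E) ?add0e.
  apply: le_measure; rewrite ?inE//; first exact: measurableI.
  by move=> s [As]; rewrite /D/= in_itv/= => /AB; exact.
apply: (subset_measure0 _ _ _ DC0); [exact: measurableD|exact: measurableC|].
by move=> s [].
Qed.

Lemma eq_lebesgue01 (A B : set R) : measurable A -> measurable B ->
  (forall s, 0 < s < 1 -> A s <-> B s) -> lebesgue01 A = lebesgue01 B.
Proof.
by move=> mA mB AB; apply/eqP; rewrite eq_le; apply/andP; split;
  apply: lebesgue01_subset => // s /AB [].
Qed.

End lebesgue01_probability.

Section quantile_theory.
Context (R : realType) (rho : probability R R).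

Let F := cumulative_function rho.

(** The identity is a random variable of law [rho] whose cdf is [F]; this gives the limits of [F] at
    infinity and its right continuity. *)
Let idR : {mfun R >-> R} := HB.pack (@idfun R)
  (isMeasurableFun.Build _ _ _ _ (@idfun R) (@measurable_id _ _ setT)).

Let FE r : F r = cdf (idR : {RV rho >-> R}) r.
Proof. by []. Qed.

Let fine_F r : F r = (fine (F r))%:E.
Proof. by rewrite fineK// fin_num_measure. Qed.

(** For 0 < s < 1 the limits of [F] at both infinities make the defining set nonempty and bounded
    below; right continuity puts its infimum in the set. *)
Lemma quantile_le (s t : R) : 0 < s < 1 ->
  (quantile rho s <= t) = (s%:E <= cumulative_function rho t)%E.
Proof.
move=> /andP[s0 s1]; rewrite -/(F t); set E := [set t | (s%:E <= F t)%E].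
have F_nd x y : x <= y -> (F x <= F y)%E.
  by move=> xy; exact: (cdf_nondecreasing (idR : {RV rho >-> R})).
have [b Eb] : exists b, E b.
  apply: contrapT => /forallNP Es; have : (1 <= s%:E)%E; last first.
    by rewrite lee_fin leNgt s1.
  apply: (cvge_to_le (cvg_cdfy1 (idR : {RV rho >-> R}))).
  by apply: nearW => x; rewrite -FE leNgt; apply/negP => /ltW /Es.
have [a Fa] : exists a, (F a < s%:E)%E.
  apply: contrapT => /forallNP Es; have : (s%:E <= 0)%E; last first.
    by rewrite lee_fin leNgt s0.
  apply: (cvge_to_ge (cvg_cdfNy0 (idR : {RV rho >-> R}))).
  by apply: nearW => x; rewrite -FE leNgt; apply/negP => /Es.
have infE : has_inf E.
  split; [by exists b|exists a => x Ex].
  by rewrite leNgt; apply/negP => /ltW /F_nd /(le_trans Ex); rewrite leNgt Fa.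
apply/idP/idP => [qt|Et]; last exact: ge_inf infE.2 _ Et.
apply: le_trans (F_nd _ _ qt).
apply: (cvge_to_ge (@cdf_right_continuous _ _ _ rho idR (quantile rho s))).
near=> r; have /(inf_lt infE.1)[x Ex /ltW /F_nd] : quantile rho s < r.
  by near: r; exact: nbhs_right_gt.
exact: le_trans.
Unshelve. all: by end_near. Qed.

Lemma quantile_lt (s t : R) : 0 < s < 1 ->
  (t < quantile rho s) = (cumulative_function rho t < s%:E)%E.
Proof. by move=> s01; rewrite !ltNge quantile_le. Qed.

Lemma quantile_nondecreasing (s s' : R) : 0 < s -> s <= s' -> s' < 1 ->
  quantile rho s <= quantile rho s'.
Proof.
move=> s0 ss' s1; rewrite quantile_le ?s0 ?(le_lt_trans ss')//.
apply: (@le_trans _ _ s'%:E); first by rewrite lee_fin.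
by rewrite -quantile_le// s1 (lt_le_trans s0).
Qed.

(** On ]0, 1[ preimages of rays are intervals by [quantile_lt]. For s <= 0 or s > 1 the defining set
    is the whole line or empty, so the quantile is a default constant there. *)
Lemma measurable_quantile : measurable_fun [set: R] (quantile rho).
Proof.
have -> : [set: R] = `]-oo, 0] `|` (`]0, 1[ `|` ([set 1] `|` `]1, +oo[)).
  apply/seteqP; split => // s _ /=; rewrite !in_itv/= andbT.
  by case: (ltgtP s 1) => s1; case: (ltP 0 s) => s0;
    first [by left | by right; left | by right; right; left | by do 3!right].
have cst_out (D : set R) c : (forall s, D s -> quantile rho s = c) ->
    measurable_fun D (quantile rho).
  move=> Dc; apply: (eq_measurable_fun (cst c)) => // s.
  by rewrite inE => /Dc.
apply/measurable_funU => //; first by do !apply: measurableU.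
split.
  apply: (cst_out _ (inf [set: R])) => s /=; rewrite in_itv/= => s0.
  congr inf; apply/seteqP; split => // t _ /=.
  by rewrite (@le_trans _ _ 0%E) ?lee_fin.
apply/measurable_funU => //; first exact: measurableU.
split.
  apply: (measurability _ (RGenOInfty.measurableE R)) => _ /= [_ [t ->] <-].
  rewrite (_ : _ `&` _ = `]0, 1[%classic `&` `](fine (F t)), +oo[%classic).
    exact: measurableI.
  apply/seteqP; split => s /=; rewrite !in_itv/= !andbT => -[s01].
    by rewrite quantile_lt// -/(F t) fine_F lte_fin.
  by move=> Fs; split => //; rewrite quantile_lt// -/(F t) fine_F lte_fin.
apply/measurable_funU => //; split; first exact: measurable_fun_set1.
apply: (cst_out _ (inf set0)) => s /=; rewrite in_itv/= andbT => s1.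
congr inf; apply/seteqP; split => // t /=.
by rewrite leNgt (le_lt_trans (probability_le1 rho _)).
Qed.

(** Inverse transform sampling: on the rays ]t, oo[, which generate the Borel sets and are stable
    under intersection, both sides equal 1 - F(t). *)
Lemma lebesgue01_quantile (A : set R) : measurable A ->
  lebesgue01 (quantile rho @^-1` A) = rho A.
Proof.
pose G := [set A : set R | exists x, A = `]x, +oo[%classic].
apply: (measure_unique G (fun n => `](- n%:R), +oo[%classic) _ _ _ _
  (image_probability (@lebesgue01 R) measurable_quantile) rho).
- exact: RGenOInfty.measurableE.
- move=> _ _ [x ->] [y ->]; exists (Num.max x y).
  by apply/seteqP; split => t /=; rewrite !in_itv/= !andbT gt_max => /andP.
- by move=> n; exists (- n%:R).
- apply/seteqP; split => // x _; exists (Num.truncn `|x|).+1 => //=.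
  rewrite in_itv/= andbT ltrNl (le_lt_trans (ler_norm _))// normrN.
  by have /andP[] := truncn_itv (normr_ge0 x).
- move=> _ [t ->].
  have F0 : 0 <= fine (F t) by rewrite fine_ge0.
  have F1 : fine (F t) <= 1 by rewrite -lee_fin -fine_F probability_le1.
  have rhoE : rho `]t, +oo[%classic = (1 - fine (F t))%:E.
    by rewrite EFinB -fine_F /F /cumulative_function -probability_setC// setCitvl.
  apply: etrans (esym rhoE); rewrite -(lebesgue01_itvo1 F0 F1).
  apply: eq_lebesgue01 => //.
    rewrite -[X in measurable X]setTI; exact: measurable_quantile.
  move=> s s01; rewrite /= !in_itv/= andbT quantile_lt// -/(F t) fine_F lte_fin.
  by case/andP: s01 => _ ->; rewrite andbT.
- by move=> n; rewrite (le_lt_trans (probability_le1 _ _)) ?ltry.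
Qed.

End quantile_theory.

(** * Optimality of the quantile coupling on the line *)

Section probability_intersection.
Set Implicit Arguments.
Unset Strict Implicit.
Context d (T : measurableType d) (R : realType) (P : probability T R).
Variables (A B : set T).
Hypothesis mA : measurable A.
Hypothesis mB : measurable B.

Lemma probability_setU_setI : (P A + P B = P (A `|` B) + P (A `&` B))%E.
Proof.
have PA := fin_num_measure P _ mA.
have PI := fin_num_measure P _ (measurableI _ _ mA mB).
by rewrite measureUfinl ?ltey_eq ?PA// subeK.
Qed.

(** The Frechet lower bound on an intersection, kept additive to avoid subtraction of extended
    reals. *)
Lemma leD_probability_setI : (P A + P B <= 1 + P (A `&` B))%E.
Proof.
by rewrite probability_setU_setI leeD2r// probability_le1//; exact: measurableU.
Qed.

End probability_intersection.

Section quantile_coupling.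
Set Implicit Arguments.
Unset Strict Implicit.
Context (R : realType).
Implicit Types rho sigma : probability R R.

(* [quantile sigma < t] cuts out an initial and [u <= quantile rho] a final
   segment of ]0, 1[, so these either are disjoint or cover ]0, 1[: the
   probability of their intersection is the least one allowed by their
   individual probabilities. *)
Lemma lebesgue01_quantile_lt_ge d (T : measurableType d) (P : probability T R)
    (X Y : T -> R) rho sigma (t u : R) :
  measurable_fun [set: T] X -> measurable_fun [set: T] Y ->
  (forall A, measurable A -> P (X @^-1` A) = rho A) ->
  (forall A, measurable A -> P (Y @^-1` A) = sigma A) ->
  (@lebesgue01 R [set s | (quantile sigma s < t)%R /\ (u <= quantile rho s)%R] <=
   P [set p | (Y p < t)%R /\ (u <= X p)%R])%E.
Proof.
move=> mX mY PX PY.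
pose A : set R := quantile sigma @^-1` `]-oo, t[%classic.
pose B : set R := quantile rho @^-1` `[u, +oo[%classic.
pose A' := Y @^-1` `]-oo, t[%classic.
pose B' := X @^-1` `[u, +oo[%classic.
have mA : measurable A.
  by rewrite -[A]setTI; apply: measurable_quantile => //; exact: measurable_itv.
have mB : measurable B.
  by rewrite -[B]setTI; apply: measurable_quantile => //; exact: measurable_itv.
have mA' : measurable A' by rewrite -[A']setTI; apply: mY => //; exact: measurable_itv.
have mB' : measurable B' by rewrite -[B']setTI; apply: mX => //; exact: measurable_itv.
rewrite (_ : [set s | _] = A `&` B); last first.
  by apply/seteqP; split => s; rewrite /A /B/= !in_itv/= andbT.
rewrite (_ : [set p | _] = A' `&` B'); last first.
  by apply/seteqP; split => s; rewrite /A' /B'/= !in_itv/= andbT.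
have [[s [s01 [As Bs]]]|AB0] := pselect (exists s, 0 < s < 1 /\ (A `&` B) s); last first.
  apply: (@le_trans _ _ 0%E) => //; rewrite -(measure0 (@lebesgue01 R)).
  apply: lebesgue01_subset => //; first exact: measurableI.
  by move=> s s01 ABs; apply: AB0; exists s.
(* A common point [s] forces the cover: [A] contains the points of ]0, 1[ left of [s], and [B] those
   right of it. *)
have AB1 : lebesgue01 (A `|` B) = 1%E.
  rewrite -(probability_setT (@lebesgue01 R : probability R R)).
  apply: eq_lebesgue01 => //; first exact: measurableU.
  move=> r /andP[r0 r1]; split => // _; apply: contrapT => /not_orP[].
  rewrite /A /B/= !in_itv/= andbT => /negP; rewrite -leNgt => tr /negP.
  rewrite -ltNge => ru.
  move: As Bs; rewrite /A /B/= !in_itv/= andbT => st us.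
  have [rs|/ltW sr] := leP r s.
    have := quantile_nondecreasing sigma r0 rs (andP s01).2.
    by rewrite leNgt (lt_le_trans st tr).
  have := quantile_nondecreasing rho (andP s01).1 sr r1.
  by rewrite leNgt (lt_le_trans ru us).
(* With 1 added, the left side is exactly the sum of the two marginal probabilities, and the Frechet
   bound controls it by the right side. *)
rewrite -(@leeD2lE _ 1%E)// -[X in (X + _)%E]AB1.
rewrite -(probability_setU_setI (@lebesgue01 R : probability R R) mA mB).
rewrite [X in (X + _)%E]lebesgue01_quantile//.
rewrite [X in (_ + X)%E]lebesgue01_quantile//.
by rewrite -PX// -PY//; exact: leD_probability_setI.
Qed.

Variable h : R -> R.
Hypothesis h_ge0 : forall x, 0 <= h x.
Hypothesis h_convex : convex_function [set: R^o] h.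
Hypothesis h0 : h 0 = 0.

(** Stated for variables on an arbitrary space, so that it serves couplings on the line, plans in
    the plane and cardinal flows alike. *)
Lemma le_quantile_cost d (T : measurableType d) (P : probability T R)
    (X Y : T -> R) rho sigma :
  measurable_fun [set: T] X -> measurable_fun [set: T] Y ->
  (forall A, measurable A -> P (X @^-1` A) = rho A) ->
  (forall A, measurable A -> P (Y @^-1` A) = sigma A) ->
  (\int[@lebesgue01 R]_s (distance_cost h (quantile rho s) (quantile sigma s))%:E <=
   \int[P]_p (distance_cost h (X p) (Y p))%:E)%E.
Proof.
move=> mX mY PX PY; apply: (@le_integral_convex_cost _ _ _ _ _
  (@lebesgue01 R : probability R R) P _ _ _ _ _ _ _ _ _ _ _ h_ge0 h_convex h0) => //;
  try exact: measurable_quantile.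
- by move=> t u; exact: lebesgue01_quantile_lt_ge.
- by move=> t u; exact: lebesgue01_quantile_lt_ge.
Qed.

Lemma measurable_distance_cost d (T : measurableType d) (U V : T -> R) :
  measurable_fun [set: T] U -> measurable_fun [set: T] V ->
  measurable_fun [set: T] (fun p => distance_cost h (U p) (V p)).
Proof.
move=> mU mV; apply: (measurable_convex_norm h_ge0 h_convex h0).
exact: measurable_funB.
Qed.

Lemma W_quantile rho sigma : W (distance_cost h) rho sigma =
  (\int[@lebesgue01 R]_s (distance_cost h (quantile rho s) (quantile sigma s))%:E)%E.
Proof.
have mQ : measurable_fun [set: R] (fun s => (quantile rho s, quantile sigma s)).
  by apply: measurable_fun_pair; exact: measurable_quantile.
apply/eqP; rewrite eq_le; apply/andP; split; last first.
  apply: le_ereal_inf_tmp => _ [pi [pi1 pi2] <-].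
  exact: le_quantile_cost.
apply: ereal_inf_lbound; exists (image_probability (@lebesgue01 R) mQ).
  by split => A mA; rewrite -(lebesgue01_quantile _ mA).
rewrite ge0_integral_image_probability//.
- by apply/measurable_EFinP; exact: measurable_distance_cost.
- by move=> p; rewrite lee_fin; exact: h_ge0.
Qed.

End quantile_coupling.

(** * Disintegration *)

Section laws.
Set Implicit Arguments.
Unset Strict Implicit.
Context d d' (T : measurableType d) (T' : measurableType d') (R : realType).

Lemma ge0_integral_law (P : probability T R) (P' : probability T' R)
    (f : T -> T') (g : T' -> \bar R) :
  measurable_fun [set: T] f -> measurable_fun [set: T'] g ->
  (forall y, 0 <= g y)%E ->
  (forall A, measurable A -> P (f @^-1` A) = P' A) ->
  (\int[P]_x g (f x) = \int[P']_y g y)%E.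
Proof.
move=> mf mg g0 PP'; rewrite -(ge0_integral_image_probability _ mf)//.
by apply: eq_measure_integral => A mA _; exact: PP'.
Qed.

Lemma eq_probability_ae (P : probability T R) (N A B : set T) :
  measurable N -> measurable A -> measurable B -> P N = 1%E ->
  (forall x, N x -> A x <-> B x) -> P A = P B.
Proof.
move=> mN mA mB PN AB.
have PNC : P (~` N) = 0%E by rewrite probability_setC// PN subee.
have PI C : measurable C -> P C = P (C `&` N).
  move=> mC; rewrite (measureDI P mC mN) [X in (X + _)%E](_ : _ = 0%E) ?add0e//.
  apply: (subset_measure0 _ _ _ PNC); [exact: measurableD|exact: measurableC|].
  by move=> x [].
rewrite PI// [RHS]PI//; congr (P _).
by apply/seteqP; split => x [Cx Nx]; split => //; apply/AB.
Qed.

Lemma eq_ge0_integral_ae (P : probability T R) (N : set T) (f g : T -> \bar R) :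
  measurable N -> P N = 1%E ->
  measurable_fun [set: T] f -> measurable_fun [set: T] g ->
  (forall x, 0 <= f x)%E -> (forall x, 0 <= g x)%E ->
  (forall x, N x -> f x = g x) -> (\int[P]_x f x = \int[P]_x g x)%E.
Proof.
move=> mN PN mf mg f0 g0 fg; apply: ge0_ae_eq_integral => //.
have PNC : P (~` N) = 0%E by rewrite probability_setC// PN subee.
exists (~` N); split; [exact: measurableC|exact: PNC|].
by move=> x /= fgx Nx; apply: fgx => _; exact: fg.
Qed.

End laws.

Section semidirect.
Set Implicit Arguments.
Unset Strict Implicit.
Context d1 d2 (T1 : measurableType d1) (T2 : measurableType d2) (R : realType).
Variables (P : probability T1 R) (k : T1 -> pprobability T2 R).
Hypothesis mk : measurable_fun [set: T1] k.

(** The product [mkproduct] takes kernels, so [P] is viewed as a kernel from the one-point type. *)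
Let P' : unit -> pprobability T1 R := fun=> P.
Let mP' : measurable_fun [set: unit] P'. Proof. exact: measurable_cst. Qed.
Let k' : unit * T1 -> pprobability T2 R := fun x => k x.2.
Let mk' : measurable_fun [set: unit * T1] k'.
Proof. exact: measurableT_comp. Qed.

Let k1 : R.-pker unit ~> T1 := kprobability mP'.
Let k2 : R.-pker (unit * T1)%type ~> T2 := kprobability mk'.

Definition semidirect : set (T1 * T2) -> \bar R := mkproduct k1 k2 tt.

HB.instance Definition _ := Measure.on semidirect.

Lemma semidirectE A : measurable A ->
  semidirect A = (\int[P]_x k x (xsection A x))%E.
Proof.
move=> mA; apply: eq_integral => x _.
exact: (@kernel.intker_indicE _ _ _ unit T1 T2 R k2 A tt x mA).
Qed.

Let semidirect_setT : semidirect setT = 1%E.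
Proof.
rewrite semidirectE// (eq_integral (cst 1%E)).
  by rewrite integral_cst// mul1e; exact: probability_setT.
move=> x _; rewrite (_ : xsection _ _ = setT) ?probability_setT//.
by apply/seteqP; split => // y _; rewrite /xsection/= inE.
Qed.

HB.instance Definition _ :=
  Measure_isProbability.Build _ _ _ semidirect semidirect_setT.

Lemma semidirect_fst A : measurable A -> semidirect (fst @^-1` A) = P A.
Proof.
move=> mA; rewrite semidirectE; last first.
  by rewrite -[X in measurable X]setTI; exact: measurable_fst.
rewrite -[in RHS](setIT A) -integral_indic//; apply: eq_integral => x _.
rewrite indicE; have [xA|xA] := boolP (x \in A).
  rewrite (_ : xsection _ _ = setT) ?probability_setT//.
  by apply/seteqP; split => // y _; rewrite /xsection/= inE; exact/set_mem.
rewrite (_ : xsection _ _ = set0) ?measure0//.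
apply/seteqP; split => // y; rewrite /xsection/= inE/= => Ax.
by rewrite (mem_set Ax) in xA.
Qed.

(** The iterated integral is one against the composed kernel, which is the second marginal of
    [semidirect]. *)
Lemma ge0_integral_integral (f : T2 -> \bar R) :
  measurable_fun [set: T2] f -> (forall y, 0 <= f y)%E ->
  (\int[P]_x \int[k x]_y f y = \int[semidirect]_p f p.2)%E.
Proof.
move=> mf f0.
rewrite -(integral_kcomp k1 k2 tt f0 mf).
have <- := ge0_integral_pushforward measurable_snd
  (semidirect : {measure set _ -> \bar R}) measurableT mf _.
  apply: eq_measure_integral => A mA _.
  rewrite /pushforward [RHS]semidirectE.
    apply: eq_integral => x _; congr (k x _).
    by apply/seteqP; split => y; rewrite /xsection/= inE.
  by rewrite -[X in measurable X]setTI; exact: measurable_snd.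
by move=> y _; exact: f0.
Qed.

End semidirect.

Section disintegration.
Set Implicit Arguments.
Unset Strict Implicit.
Context d1 d2 (T1 : measurableType d1) (T2 : measurableType d2) (R : realType).
Variables (nu : probability (T1 * T2)%type R) (k : T1 -> pprobability T2 R).
Hypothesis nuk : is_conditional_law nu k.

(** The definition of a conditional law gives agreement on rectangles, a generating family stable
    under intersection. *)
Lemma conditional_lawE A : measurable A -> nu A = semidirect (marginal1 nu) nuk.1 A.
Proof.
pose C : set (set (T1 * T2)) :=
  [set C | exists A, measurable A /\ exists B, measurable B /\ C = A `*` B].
apply: (measure_unique C (fun=> setT)) => //.
- rewrite measurable_prod_measurableType//; congr (<<s _ >>).
  rewrite predeqE => E; split => [[A1 mA1 [A2 mA2 <-]]|[A1 [mA1 [A2 [mA2 ->]]]]].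
    by exists A1; split => //; exists A2.
  by exists A1 => //; exists A2.
- move=> _ _ [X1 [mX1 [X2 [mX2 ->]]]] [Y1 [mY1 [Y2 [mY2 ->]]]].
  rewrite -setXI; exists (X1 `&` Y1); split; first exact: measurableI.
  by exists (X2 `&` Y2); split => //; exact: measurableI.
- by move=> _; exists setT; split => //; exists setT; split => //; rewrite setXTT.
- by rewrite bigcup_const//; exists 0%N.
- move=> _ [A1 [mA1 [A2 [mA2 ->]]]]; apply: etrans (nuk.2 _ _ mA1 mA2) _.
  rewrite [RHS]semidirectE; last exact: measurableX.
  rewrite integral_mkcond; apply: eq_integral => x _; rewrite patchE.
  case: ifPn => xA; first by rewrite in_xsectionX.
  by rewrite notin_xsectionX// measure0.
- by move=> _; rewrite (le_lt_trans (probability_le1 _ _)) ?ltry.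
Qed.

Lemma ge0_integral_conditional_law (f : T2 -> \bar R) :
  measurable_fun [set: T2] f -> (forall y, 0 <= f y)%E ->
  (\int[marginal1 nu]_x \int[k x]_y f y = \int[nu]_p f p.2)%E.
Proof.
move=> mf f0; rewrite (ge0_integral_integral _ nuk.1)//.
by apply: eq_measure_integral => A mA _; rewrite [RHS]conditional_lawE.
Qed.

End disintegration.

(** * Cardinal flows *)

Section quantile_flows.
Set Implicit Arguments.
Unset Strict Implicit.
Context (R : realType) (mu nu : probability (R * R)%type R).

Lemma measurable_quantile_flow1 : measurable_fun [set: R]
  (fun s => ((quantile (marginal1 mu) s, 0 : R), quantile (marginal1 nu) s)).
Proof.
apply: measurable_fun_pair; last exact: measurable_quantile.
by apply: measurable_fun_pair => //; exact: measurable_quantile.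
Qed.

(** A single push-forward of Lebesgue measure with x_2 = 0 built in: a probability by construction,
    with integrals computed by change of variables. *)
Let flow1 : probability ((R * R) * R)%type R :=
  image_probability (@lebesgue01 R) measurable_quantile_flow1.

Lemma quantile_flow1E A : measurable A -> flow1 A = quantile_flow1 mu nu A.
Proof.
move=> mA; pose r (p : (R * R) * R) := ((p.1.1, p.2), p.1.2).
have mr : measurable_fun setT r.
  by apply: measurable_fun_pair => /=; [apply: measurable_fun_pair => //=|];
    exact: measurableT_comp.
have mrA : measurable (r @^-1` A) by rewrite -[X in measurable X]setTI; exact: mr.
have mQ : measurable_fun [set: R]
    (fun s => (quantile (marginal1 mu) s, quantile (marginal1 nu) s)).
  by apply: measurable_fun_pair; exact: measurable_quantile.
rewrite /quantile_flow1 {1}/pushforward /product_measure1 -/r.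
have := ge0_integral_image_probability (@lebesgue01 R) mQ
  (measurable_fun_xsection (\d_(0 : R)) mrA) (fun=> measure_ge0 _ _).
move=> /= ->.
pose B := (fun s =>
  ((quantile (marginal1 mu) s, 0 : R), quantile (marginal1 nu) s)) @^-1` A.
have mB : measurable B by rewrite -[B]setTI; exact: measurable_quantile_flow1.
transitivity (lebesgue01 (B `&` setT)); first by rewrite setIT.
apply: etrans (esym (integral_indic (@lebesgue01 R) measurableT mB)) _.
apply: eq_integral => s _.
rewrite /= /dirac !indicE /xsection; congr (nat_of_bool _)%:R%:E.
by apply/idP/idP; rewrite !inE /= inE.
Qed.

Variable nu_cond : R -> pprobability R R.
Hypothesis nu_condP : is_conditional_law nu nu_cond.

Lemma measurable_insert0 : measurable_fun [set: R * R] (fun y : R * R => (0 : R, y)).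
Proof. exact: measurable_fun_pair. Qed.

(** Since x_2 = 0, the second flow is nu with a zero inserted; conditional laws enter only when it
    is identified with [quantile_flow2]. *)
Let flow2 : probability (R * (R * R))%type R := image_probability nu measurable_insert0.

Lemma quantile_flow2E A : measurable A -> flow2 A = quantile_flow2 nu nu_cond A.
Proof.
move=> mA; pose B := (fun y : R * R => (0 : R, y)) @^-1` A.
have mB : measurable B by rewrite -[B]setTI; exact: measurable_insert0.
apply: etrans (conditional_lawE nu_condP mB) _.
rewrite semidirectE//; apply: eq_integral => y1 _.
pose Q := image_probability (@lebesgue01 R) (measurable_quantile (nu_cond y1)).
pose C := [set p : R * R | A (p.1, (y1, p.2))].
have mC : measurable C.
  rewrite -[C]setTI; suff mg : measurable_fun setT (fun p : R * R => (p.1, (y1, p.2))).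
    exact: mg.
  by apply: measurable_fun_pair => //; exact: measurable_fun_pair.
rewrite /product_measure1.
have := integral_dirac (0 : R) measurableT (measurable_fun_xsection Q mC).
rewrite /= diracT mul1e => ->.
apply: etrans (esym (lebesgue01_quantile (nu_cond y1) _)) _.
  exact: measurable_xsection.
by rewrite /Q /=; congr (lebesgue01 _).
Qed.

Hypothesis mu_x2 : mu [set x | x.2 = 0] = 1%E.

Lemma measurable_axis : measurable [set x : R * R | x.2 = 0].
Proof.
rewrite (_ : [set _ | _] = setT `&` snd @^-1` [set 0]).
  exact: measurable_snd.
by rewrite setTI.
Qed.

Lemma axis_law A : measurable A -> mu A = marginal1 mu [set x | A (x, 0)].
Proof.
move=> mA; apply: (eq_probability_ae measurable_axis) => //.
  have mf : measurable_fun setT (fun x : R * R => (x.1, 0 : R)).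
    exact: measurable_fun_pair.
  by rewrite -[X in measurable X]setTI; exact: mf.
by move=> [x1 x2] /= ->.
Qed.

Lemma is_cardinal_flow_quantile : is_cardinal_flow mu nu flow1 flow2.
Proof.
have ms0 : measurable_fun setT (fun x : R => (x, 0 : R)) by exact: measurable_fun_pair.
have mpre (A : set (R * R)) : measurable A -> measurable [set x : R | A (x, 0)].
  by move=> mA; rewrite -[X in measurable X]setTI; exact: ms0.
split => A mA.
- by rewrite axis_law// -(lebesgue01_quantile _ (mpre _ mA)).
- by [].
(* Under both flows, (y_1, x_2) has law nu_1 on the axis x_2 = 0. *)
- exact: (lebesgue01_quantile _ (mpre _ mA)).
Qed.

Variable h : R -> R.
Hypothesis h_ge0 : forall x, 0 <= h x.
Hypothesis h_convex : convex_function [set: R^o] h.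
Hypothesis h0 : h 0 = 0.
Let c := distance_cost h.

Let mc d (T : measurableType d) (U V : T -> R) :
  measurable_fun [set: T] U -> measurable_fun [set: T] V ->
  measurable_fun [set: T] (fun p => (c (U p) (V p))%:E).
Proof. by move=> mU mV; apply/measurable_EFinP; exact: measurable_distance_cost. Qed.

Let c_ge0 x y : (0 <= (c x y)%:E)%E. Proof. by rewrite lee_fin; exact: h_ge0. Qed.

Lemma integral_cost_from0 d (T : measurableType d) (P : probability T R) (X Y : T -> R) :
  measurable_fun [set: T] X -> measurable_fun [set: T] Y ->
  P (X @^-1` [set 0]) = 1%E ->
  (\int[P]_p (c (X p) (Y p))%:E = \int[P]_p (c 0 (Y p))%:E)%E.
Proof.
move=> mX mY X0; apply: (eq_ge0_integral_ae _ X0) => //; try exact: mc.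
  by rewrite -[X in measurable X]setTI; exact: mX.
by move=> p /= ->.
Qed.

(** All couplings with a Dirac mass have the same cost, so the infimum is that value once one
    coupling is exhibited. *)
Lemma W_dirac0 (rho : probability R R) :
  W c (\d_(0 : R)) rho = (\int[rho]_y (c 0 y)%:E)%E.
Proof.
have m0 : measurable_fun setT (fun y : R => (0 : R, y)) by exact: measurable_fun_pair.
have cost (pi : probability (R * R)%type R) : is_coupling (\d_(0 : R)) rho pi ->
    (\int[pi]_p (c p.1 p.2)%:E = \int[rho]_y (c 0 y)%:E)%E.
  move=> [pi1 pi2]; rewrite integral_cost_from0//; last first.
    apply: etrans (pi1 _ _) _ => //.
    by rewrite /= /dirac indicE mem_set.
  by apply: (ge0_integral_law (g := fun y => (c 0 y)%:E)) => //; exact: mc.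
apply/eqP; rewrite eq_le; apply/andP; split; last first.
  by apply: le_ereal_inf_tmp => _ [pi /cost -> <-].
pose pi := image_probability rho m0.
have pi_coupling : is_coupling (\d_(0 : R)) rho pi.
  split=> A mA //; rewrite [RHS]/= /dirac indicE.
  have [A0|A0] := boolP (0 \in A).
    apply: etrans (probability_setT rho); congr (rho _).
    by apply/seteqP; split => // y _ /=; exact/set_mem.
  apply: etrans (measure0 rho); congr (rho _).
  by apply/seteqP; split => // y /= /mem_set; rewrite (negbTE A0).
by apply: ereal_inf_lbound; exists pi => //; exact: cost.
Qed.

Lemma flow_cost_quantile : flow_cost c c flow1 flow2 =
  (W c (marginal1 mu) (marginal1 nu) + \int[nu]_y (c 0 y.2)%:E)%E.
Proof.
congr (_ + _)%E.
  rewrite W_quantile// ge0_integral_image_probability//.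
  apply: mc; last exact: measurable_snd.
  exact: measurableT_comp.
by rewrite ge0_integral_image_probability//; apply: mc => //; exact: measurableT_comp.
Qed.

(** The two terms are bounded separately. The gluing condition carries the law nu_1 of y_1 from [g2]
    to [g1], and the law of x_2, concentrated at 0, from [g1] to [g2]. *)
Lemma is_optimal_quantile_flow : is_optimal_cardinal_flow c c mu nu flow1 flow2.
Proof.
split; first exact: is_cardinal_flow_quantile.
move=> g1 g2 [g1mu g2nu g12]; rewrite flow_cost_quantile /flow_cost.
apply: leeD.
  rewrite W_quantile//; apply: le_quantile_cost => //.
  - exact: measurableT_comp.
  - move=> A mA; apply: g1mu.
    by rewrite -[X in measurable X]setTI; exact: measurable_fst.
  - move=> A mA.
    have mA1 : measurable (fst @^-1` A : set (R * R)).
      by rewrite -[X in measurable X]setTI; exact: measurable_fst.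
    exact: etrans (g12 _ mA1) (g2nu _ mA1).
rewrite integral_cost_from0//.
- rewrite (ge0_integral_law (f := snd) (P' := nu) (g := fun y : R * R => (c 0 y.2)%:E))//.
  exact: mc.
- exact: measurableT_comp.
- apply: etrans (esym (g12 _ measurable_axis)) _.
  exact: etrans (g1mu _ measurable_axis) mu_x2.
Qed.

(** Every plan has the same second cost. Its (x_1, y_1) projection gives the lower bound, and a plan
    extending the quantile coupling attains it. *)
Lemma W_separable :
  W (separable_cost c c) mu nu =
  (W c (marginal1 mu) (marginal1 nu) + \int[nu]_y (c 0 y.2)%:E)%E.
Proof.
have cost (pi : probability ((R * R) * (R * R))%type R) : is_coupling mu nu pi ->
    (\int[pi]_p (separable_cost c c p.1 p.2)%:E =
     \int[pi]_p (c p.1.1 p.2.1)%:E + \int[nu]_y (c 0 y.2)%:E)%E.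
  move=> [pi1 pi2]; rewrite /separable_cost; under eq_integral do rewrite EFinD.
  rewrite ge0_integralD//; last 2 first.
  - by apply: mc; exact: measurableT_comp.
  - by apply: mc; exact: measurableT_comp.
  congr (_ + _)%E; rewrite integral_cost_from0//.
  - rewrite (ge0_integral_law (f := snd) (P' := nu) (g := fun y : R * R => (c 0 y.2)%:E))//.
    exact: mc.
  - exact: measurableT_comp.
  - exact: measurableT_comp.
  - exact: etrans (pi1 _ measurable_axis) mu_x2.
apply/eqP; rewrite eq_le; apply/andP; split; last first.
  apply: le_ereal_inf_tmp => _ [pi piP <-]; rewrite cost// leeD2r//.
  rewrite W_quantile//; apply: le_quantile_cost => //; try exact: measurableT_comp.
  - move=> A mA; apply: (piP.1 (fst @^-1` A)).
    by rewrite -[X in measurable X]setTI; exact: measurable_fst.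
  - move=> A mA; apply: (piP.2 (fst @^-1` A)).
    by rewrite -[X in measurable X]setTI; exact: measurable_fst.
have mk : measurable_fun setT (nu_cond \o (snd : R * R -> R)).
  exact: measurableT_comp nu_condP.1 measurable_snd.
pose Q s := (quantile (marginal1 mu) s, quantile (marginal1 nu) s).
have mQ : measurable_fun [set: R] Q.
  by apply: measurable_fun_pair; exact: measurable_quantile.
pose gamma := image_probability (@lebesgue01 R) mQ.
(* The optimal plan: draw (x_1, y_1) from [gamma], then y_2 from the conditional law at y_1, and set
   x_2 = 0. *)
pose glue (q : (R * R) * R) := ((q.1.1, 0 : R), (q.1.2, q.2)).
have mglue : measurable_fun setT glue.
  by apply: measurable_fun_pair; apply: measurable_fun_pair => //; exact: measurableT_comp.
pose lambda := semidirect gamma mk.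
pose pi := image_probability lambda mglue.
have lambda1 A : measurable A -> lambda (fst @^-1` A) = gamma A.
  exact: semidirect_fst.
have piP : is_coupling mu nu pi.
  split => A mA.
    have m0 : measurable [set x : R | A (x, 0)].
      have mf : measurable_fun setT (fun x : R => (x, 0 : R)) by exact: measurable_fun_pair.
      by rewrite -[X in measurable X]setTI; exact: mf.
    apply: etrans (lambda1 [set p | A (p.1, 0)] _) _.
      by rewrite -[X in measurable X]setTI; exact: (measurable_fst measurableT _ m0).
    by rewrite axis_law//; exact: (lebesgue01_quantile _ m0).
  have mS : measurable [set q : (R * R) * R | A (q.1.2, q.2)].
    rewrite -[X in measurable X]setTI.
    suff mf : measurable_fun setT (fun q : (R * R) * R => (q.1.2, q.2)) by exact: mf.
    by apply: measurable_fun_pair => //; exact: measurableT_comp.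
  have mkA := measurable_fun_xsection_finite_kernel (kprobability nu_condP.1) (mem_set mA).
  (* The kernel sees only y_1, whose law under [gamma] is nu_1, so this integral is the
     disintegration of nu. *)
  apply: etrans (semidirectE gamma mk mS) _.
  rewrite [RHS](conditional_lawE nu_condP)// semidirectE//.
  rewrite -(ge0_integral_law (f := snd) (P := gamma) measurable_snd mkA)// => B mB.
  exact: lebesgue01_quantile.
apply: ereal_inf_lbound; exists pi => //.
rewrite cost//; congr (_ + _)%E.
rewrite ge0_integral_image_probability//; last first.
  by apply: mc; exact: measurableT_comp.
rewrite W_quantile//.
rewrite (ge0_integral_law (f := fst) (P' := gamma) (g := fun p : R * R => (c p.1 p.2)%:E))//.
  by rewrite ge0_integral_image_probability//; exact: mc.
exact: mc.
Qed.

End quantile_flows.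

Theorem theorem9 (R : realType) (h : R -> R)
  (h_ge0 : forall x, 0 <= h x)
  (h_convex : convex_function [set: R^o] h)
  (h0 : h 0 = 0)
  (mu nu : probability (R * R)%type R)
  (mu_x2 : mu [set x | x.2 = 0] = 1%E)
  (nu_cond : R -> pprobability R R)
  (nu_condP : is_conditional_law nu nu_cond) :
  (exists (f1 : probability ((R * R) * R)%type R)
          (f2 : probability (R * (R * R))%type R),
     [/\ forall A, measurable A -> f1 A = quantile_flow1 mu nu A,
         forall A, measurable A -> f2 A = quantile_flow2 nu nu_cond A
       & is_optimal_cardinal_flow (distance_cost h) (distance_cost h)
           mu nu f1 f2]) /\
  W (separable_cost (distance_cost h) (distance_cost h)) mu nu =
    (W (distance_cost h) (marginal1 mu) (marginal1 nu)
     + \int[marginal1 nu]_y1 W (distance_cost h) (\d_(0%R : R)) (nu_cond y1))%E.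
Proof.
split.
  exists (image_probability (@lebesgue01 R) (measurable_quantile_flow1 mu nu)).
  exists (image_probability nu (@measurable_insert0 R)); split.
  - exact: quantile_flow1E.
  - exact: quantile_flow2E.
  - exact: is_optimal_quantile_flow.
rewrite (W_separable nu_condP mu_x2 h_ge0 h_convex h0); congr (_ + _)%E.
(* Each inner transport cost is an explicit integral under the conditional law; averaging over nu_1
   recovers the integral under nu. *)
under [RHS]eq_integral do rewrite W_dirac0//.
rewrite (ge0_integral_conditional_law nu_condP (f := fun y => (distance_cost h 0 y)%:E))//.
  by apply/measurable_EFinP; exact: measurable_distance_cost.
by move=> y; rewrite lee_fin; exact: h_ge0.
Qed.
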